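(* Let $q\ge 1$ and $d\ge 1$ be integers and let $G$ be any $d$-degenerate graph. In the $q$-color online Ramsey game, Builder has a strategy which, against every strategy of Painter, forces Painter after finitely many moves to have produced a monochromatic copy of $G$, while the graph formed by all edges exposed by Builder is at all times $(qd-(q-1))$-degenerate.
   Context: The $q$-color online Ramsey game is played by two players, Builder and Painter, on an infinite set of vertices which initially spans no edges. In each step Builder exposes a new edge between two vertices, and Painter immediately colors this edge with one of $q$ colors. Builder's aim is to force the existence of a monochromatic copy of a fixed graph $G$ (a copy of $G$ all of whose edges receive the same color). A graph is $k$-degenerate if every subgraph of it has a vertex of degree at most $k$; equivalently, its vertices can be ordered $u_1,\dots,u_N$ so that each $u_i$ has at most $k$ neighbors $u_j$ with $j<i$. *)

(* Defs.v *)
From mathcomp Require Import all_boot.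

Set Implicit Arguments.
Unset Strict Implicit.
Unset Printing Implicit Defensive.

Definition simple_graph (V : Type) (e : rel V) : Prop :=
  symmetric e /\ irreflexive e.

(* A subgraph is a nonempty finite vertex set, listed without repetition as
   [S], with an edge relation [f] contained in [e]; only the [f]-edges with
   both ends in [S] belong to it, and [count (f x) S] is the degree of [x].
   Finite subgraphs suffice even when [V] is infinite, as long as [e] has
   finitely many edges: an infinite subgraph then has an isolated vertex. *)
Definition degenerate (V : eqType) (k : nat) (e : rel V) : Prop :=
  forall (S : seq V) (f : rel V),
    uniq S -> S <> [::] -> symmetric f -> subrel f e ->
    exists2 x, x \in S & count (f x) S <= k.

Definition infinite_type (V : eqType) : Prop :=
  forall s : seq V, exists x, x \notin s.

Section OnlineRamsey.

Variables (V : eqType) (q : nat).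

(* The exposed edges with their colors, most recent first. The pair (x, y)
   stands for the unordered edge {x, y}, in the orientation Builder used. *)
Definition history := seq (V * V * 'I_q).

Definition color_class (h : history) (c : 'I_q) : rel V :=
  fun x y => ((x, y, c) \in h) || ((y, x, c) \in h).

Definition exposed (h : history) : rel V :=
  fun x y => [exists c, color_class h c x y].

Definition builder := history -> V * V.
Definition painter := history -> V * V -> 'I_q.

Definition legal_move (h : history) (m : V * V) : Prop :=
  m.1 != m.2 /\ ~~ exposed h m.1 m.2.

(* The game is not stopped when a monochromatic copy appears. *)
Fixpoint play (B : builder) (P : painter) (n : nat) : history :=
  if n is n'.+1 then
    let h := play B P n' in (B h, P h (B h)) :: h
  else [::].

(* Copies need not be induced. *)
Definition mono_copy (T : Type) (e : rel T) (h : history) : Prop :=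
  exists (c : 'I_q) (phi : T -> V),
    injective phi /\ forall x y, e x y -> color_class h c (phi x) (phi y).

End OnlineRamsey.

(* Main.v *)
(** Put k = q(d-1)+1.  Builder keeps a large independent set Z such that every
    graph placed on Z that is k-degenerate leaves the whole exposed graph
    k-degenerate.  In one round, Builder splits Z into W and X and joins each
    k-subset of W to a vertex of X of its own; by pigeonhole, d of these k edges
    get the same color.  Ramsey's theorem for d-subsets, colored by a color in
    which they have a common neighbor in X, gives a large W' within W and a
    color c such that every d-subset of W' has a common c-neighbor in Z outside
    W'.  Builder goes on with W'.  After more than q|G| rounds some color c
    occurs more than |G| times.  Going backwards through these rounds, from the
    smallest set to the largest, G is embedded in color c vertex by vertex along
    a d-degenerate ordering. *)

Require Import Defs.
From mathcomp Require Import all_boot.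

Set Implicit Arguments.
Unset Strict Implicit.
Unset Printing Implicit Defensive.

(** * Pigeonhole, Ramsey's theorem and padding of small sets *)

Lemma pigeonhole_count (A : finType) (V : eqType) (P : A -> pred V) (n : nat)
    (s : seq V) :
  (forall y, y \in s -> exists c, P c y) -> #|A| * n < size s ->
  exists c, n < count (P c) s.
Proof.
move=> cov big.
have le_sum : size s <= \sum_c count (P c) s.
  elim: s cov {big} => [|y s IHs] cov //=.
  rewrite big_split /= -add1n leq_add //; last first.
    by apply: IHs => z zs; apply: cov; rewrite inE zs orbT.
  have [c Pcy] := cov y (mem_head _ _).
  by rewrite (bigD1 c) //= Pcy.
apply/existsP; apply: contraLR big; rewrite negb_exists => /forallP small.
rewrite -leqNgt (leq_trans le_sum) // -sum_nat_const.
by apply: leq_sum => c _; rewrite leqNgt small.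
Qed.

(* [d]-subsets are represented by subsequences of length [d], which makes the
   first element available for the induction on [d]. *)
Lemma ramsey (A : finType) (V : eqType) (d m : nat) :
  exists N, forall (s : seq V) (f : seq V -> A), N <= size s ->
    exists s' c, [/\ subseq s' s, size s' = m &
      forall t, subseq t s' -> size t = d -> f t = c].
Proof.
elim: d m => [|d IHd] m.
  exists m => s f le_ms; exists (take m s), (f [::]).
  by split=> [||t _ /size0nil-> //]; rewrite ?take_subseq ?size_takel.
(* First make the color depend only on the first element, by applying the case [d] to the coloring
   [t] -> [f (x :: t)] for each chosen [x] in turn. Pigeonhole on the values of [g] then
   finishes. *)
have min_homogeneous k : exists N, forall (s : seq V) (f : seq V -> A),
    N <= size s -> exists s' g, [/\ subseq s' s, size s' = k &
      forall x t, subseq (x :: t) s' -> size t = d -> f (x :: t) = g x].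
  elim: k => [|k [N1 IHk]].
    by exists 0 => s f _; exists [::], (fun=> f [::]); split; rewrite ?sub0seq.
  have [N HN] := IHd N1; exists N.+1 => -[//|x s] f le_Ns.
  have [s1 [c [s1s sz1 hom1]]] := HN s (fun t => f (x :: t)) le_Ns.
  have [|s2 [g [s2s1 sz2 hom2]]] := IHk s1 f; first by rewrite sz1.
  exists (x :: s2), (fun y => if y == x then c else g y); split.
  - by rewrite /= eqxx (subseq_trans s2s1).
  - by rewrite /= sz2.
  - move=> y t /=; case: eqP => [-> t_s2|_]; last exact: hom2.
    by apply: hom1; apply: subseq_trans s2s1.
have [N HN] := min_homogeneous (#|A| * m).+1.
exists N => s f /(HN s f) [s' [g [s's sz hom]]].
have [||c ltmc] := @pigeonhole_count A V (fun c x => g x == c) m s'.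
- by move=> y _; exists (g y).
- by rewrite sz.
set F := [seq x <- s' | g x == c]; exists (take m F), c.
have FS : subseq (take m F) s'.
  exact: subseq_trans (take_subseq _ _) (filter_subseq _ _).
split=> [||[//|x t] xt [szt]].
- exact: subseq_trans FS s's.
- by rewrite size_takel // size_filter ltnW.
- rewrite (hom x t) ?(subseq_trans xt) //.
  have := mem_subseq (subseq_trans xt (take_subseq _ _)) (mem_head _ _).
  by rewrite mem_filter => /andP[/eqP].
Qed.

(** Ramsey's theorem concerns subsequences of length exactly [d], while the neighbors met in an
    embedding form a list of at most [d] vertices in any order. *)
Lemma pad_subset (V : eqType) (W t : seq V) (d : nat) :
  uniq W -> d <= size W -> size t <= d -> {subset t <= W} ->
  exists t', [/\ subseq t' W, size t' = d & {subset t <= t'}].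
Proof.
(* [u] rearranges [W] with the entries of [t] in front, so that its first [d] entries include all of
   them. *)
move=> uW dW szt tW; pose u := undup t ++ [seq x <- W | x \notin t].
have uu : uniq u.
  rewrite cat_uniq undup_uniq filter_uniq // andbT /=.
  apply/hasPn => x; rewrite mem_filter => /andP[xt _].
  by rewrite /= mem_undup.
have uE : u =i W.
  move=> x; rewrite mem_cat mem_undup mem_filter.
  by case: (boolP (x \in t)) => [/tW->|].
have szu : size u = size W by apply/perm_size/uniq_perm.
exists [seq x <- W | x \in take d u]; split; first exact: filter_subseq.
  have -> : d = size (take d u) by rewrite size_takel // szu.
  apply/perm_size/uniq_perm; rewrite ?filter_uniq ?take_uniq //.
  move=> x; rewrite mem_filter -uE size_takel ?szu // andb_idr //.
  exact: mem_take.
move=> x xt; rewrite mem_filter tW // andbT /u take_cat.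
case: ltnP => [lt_d|_]; last by rewrite mem_cat mem_undup xt.
by have := leq_trans (leq_trans lt_d (size_undup t)) szt; rewrite ltnn.
Qed.

(** * Builder's strategies and the degeneracy of the exposed graph *)

Section Strategies.

Variables (V : eqType) (q k : nat).
Implicit Types (h : history V q) (Q : history V q -> Prop).

(** A well-founded tree branching over Painter's answers: every branch ends after finitely many
    moves, and strategies compose by grafting at [Stop]. *)
Inductive strategy := Stop | Move of V * V & ('I_q -> strategy).

Fixpoint wins Q (s : strategy) h : Prop :=
  match s with
  | Stop => Q h
  | Move m F =>
      [/\ legal_move h m, forall c, degenerate k (exposed ((m, c) :: h)) &
          forall c, wins Q (F c) ((m, c) :: h)]
  end.

Definition forces Q h : Prop := exists s, wins Q s h.

Lemma forces_now Q h : Q h -> forces Q h.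
Proof. by exists Stop. Qed.

Lemma forces_move Q h m :
  legal_move h m -> (forall c, degenerate k (exposed ((m, c) :: h))) ->
  (forall c, forces Q ((m, c) :: h)) -> forces Q h.
Proof. by move=> lm dm /fin_all_exists[F wF]; exists (Move m F). Qed.

Lemma forces_bind Q Q' h :
  forces Q h -> (forall h', Q h' -> forces Q' h') -> forces Q' h.
Proof.
case=> s; elim: s h => [|m F IH] h /= => [Qh|[lm dm wF]] QQ'; first exact: QQ'.
by apply: (forces_move lm dm) => c; apply: IH (wF c) QQ'.
Qed.

Lemma exposed_cons h x y c a b :
  exposed ((x, y, c) :: h) a b =
  ((a == x) && (b == y) || (b == x) && (a == y)) || exposed h a b.
Proof.
apply/existsP/orP => [[c']|[E|/existsP[c' hab]]].
- rewrite /color_class !inE !xpair_eqE.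
  case/orP=> /orP[/andP[-> _]|hab]; rewrite ?orbT; try (by left); right.
  + by apply/existsP; exists c'; rewrite /color_class hab.
  + by apply/existsP; exists c'; rewrite /color_class hab orbT.
- exists c; rewrite /color_class !inE !xpair_eqE eqxx !andbT.
  by case/orP: E => ->; rewrite ?orbT.
- exists c'; move: hab; rewrite /color_class !inE.
  by case/orP=> ->; rewrite !orbT.
Qed.

Lemma exposed_sub h h' x y :
  {subset h <= h'} -> exposed h x y -> exposed h' x y.
Proof.
move=> hh' /existsP[c cxy]; apply/existsP; exists c.
by case/orP: cxy => /hh'; rewrite /color_class => ->; rewrite ?orbT.
Qed.

Lemma color_class_sub h h' c x y :
  {subset h <= h'} -> color_class h c x y -> color_class h' c x y.
Proof. by move=> hh' /orP[] /hh'; rewrite /color_class => ->; rewrite ?orbT. Qed.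

(* This only involves degrees of vertices outside [Z], so adding edges inside
   [Z] preserves it. *)
Definition degenerate_off (Z : seq V) h : Prop :=
  forall S, uniq S -> ~~ all (mem Z) S ->
  exists x, [/\ x \in S, x \notin Z & count (exposed h x) S <= k].

Definition independent (Z : seq V) h : Prop :=
  {in Z &, forall x y, ~~ exposed h x y}.

Definition open_set (Z : seq V) h : Prop :=
  degenerate_off Z h /\ independent Z h.

(** A subgraph inside [Z] has no edges; any other one has a vertex of small degree outside [Z]. *)
Lemma open_set_degenerate Z h : open_set Z h -> degenerate k (exposed h).
Proof.
move=> [dZ iZ] S f uS nS _ sf.
have [SZ|/(dZ S uS)[x [xS _ le_k]]] := boolP (all (mem Z) S); last first.
  by exists x => //; apply: leq_trans le_k; apply: sub_count => y /sf.
case: S nS SZ {uS} => [//|x S _ /allP SZ]; exists x; first exact: mem_head.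
suff /eqP-> : count (f x) (x :: S) == 0 by [].
rewrite -leqn0 leqNgt -has_count; apply/hasPn => y yS.
by apply: contra (iZ x y (SZ _ (mem_head _ _)) (SZ _ yS)); apply: sf.
Qed.

Lemma open_set_sub Z Z' h :
  {subset Z' <= Z} -> open_set Z h -> open_set Z' h.
Proof.
move=> ZZ' [dZ iZ]; split; last first.
  by move=> x y /ZZ' xZ /ZZ' yZ; apply: iZ.
move=> S uS; have [SZ|/(dZ S uS)[x [xS xZ le_k]] _] := boolP (all (mem Z) S).
  case/allPn=> x xS xZ'; exists x; split=> //.
  suff /eqP-> : count (exposed h x) S == 0 by [].
  rewrite -leqn0 leqNgt -has_count; apply/hasPn => y yS.
  by apply: iZ; [move/allP: SZ => /(_ x xS)|move/allP: SZ => /(_ y yS)].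
by exists x; split=> //; apply: contra xZ; apply: ZZ'.
Qed.

(** The only new sets [S] lie inside [x :: Z] and contain [x], whose degree in [S] is then bounded
    by its degree in [x :: Z]. *)
Lemma degenerate_off_peel x Z h :
  degenerate_off (x :: Z) h -> count (exposed h x) (x :: Z) <= k ->
  degenerate_off Z h.
Proof.
move=> dxZ le_k S uS SZ.
have [/allP SxZ|/(dxZ S uS)[y [yS]]] := boolP (all (mem (x :: Z)) S).
  case/allPn: SZ => y yS /= yZ; have := SxZ y yS.
  rewrite /= inE (negPf yZ) orbF => /eqP eyx; subst y.
  exists x; split=> //; apply: leq_trans le_k; rewrite -!size_filter.
  apply: uniq_leq_size; first exact: filter_uniq.
  by move=> z; rewrite !mem_filter => /andP[-> /SxZ].
by rewrite inE negb_or => /andP[_ yZ] le; exists y.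
Qed.

(** The new edges lie inside [x :: Z], so they leave [degenerate_off (x :: Z)] intact. The sum
    bounded by [k] is the edge budget of [x]; it lets [x] be peeled off after every move. *)
Lemma forces_star x Z t h :
  uniq Z -> x \notin Z -> uniq t -> {subset t <= Z} ->
  degenerate_off (x :: Z) h -> independent Z h -> ~~ exposed h x x ->
  (forall y, y \in t -> ~~ exposed h x y) ->
  count (exposed h x) Z + size t <= k ->
  forces (fun h' => [/\ open_set Z h', {subset h <= h'} &
                        forall y, y \in t -> exposed h' x y]) h.
Proof.
move=> uZ xZ; elim: t h => [|y t IHt] h ut tZ dh ih xx nxt le_k.
  apply: forces_now; split=> //; split=> //.
  apply: degenerate_off_peel dh _.
  by rewrite /= (negPf xx) add0n -[leqLHS]addn0.
have yZ : y \in Z by apply: tZ; apply: mem_head.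
have nxy : x != y by apply: contra xZ => /eqP->.
have ltyk c : count (exposed ((x, y, c) :: h) x) Z + size t <= k.
  apply: leq_trans le_k; rewrite /= addnS -addSn leq_add2r.
  apply: leq_trans (_ : count (predU (pred1 y) (exposed h x)) Z <= _).
    apply: sub_count => b /=; rewrite exposed_cons eqxx (negPf nxy) andbF.
    by rewrite orbF.
  rewrite -[leqLHS](addnK (count (predI (pred1 y) (exposed h x)) Z)).
  by rewrite count_predUI count_uniq_mem // yZ add1n leq_subr.
have iZ c : independent Z ((x, y, c) :: h).
  move=> a b aZ bZ; rewrite exposed_cons (negPf (ih a b aZ bZ)) orbF.
  have nx z : z \in Z -> z == x = false.
    by move=> zZ; apply: contraNF xZ => /eqP<-.
  by rewrite !nx.
have dZ c : degenerate_off (x :: Z) ((x, y, c) :: h).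
  move=> S uS /(dh S uS)[a [aS axZ le_a]]; exists a; split=> //.
  apply: leq_trans le_a; apply: sub_count => b; rewrite exposed_cons.
  have [-> ->] : (a == x) = false /\ (a == y) = false; last first.
    by rewrite andbF.
  by split; apply: contraNF axZ => /eqP->; rewrite inE ?eqxx ?yZ ?orbT.
have nxx c : ~~ exposed ((x, y, c) :: h) x x.
  by rewrite exposed_cons (negPf nxy) andbF (negPf xx).
move: ut => /= /andP[yt ut].
apply: (@forces_move _ _ (x, y)).
- by split=> //=; apply: nxt; apply: mem_head.
- move=> c; apply: (@open_set_degenerate Z); split=> //.
  apply: degenerate_off_peel (dZ c) _ => /=.
  by rewrite (negPf (nxx c)) add0n (leq_trans _ (ltyk c)) ?leq_addr.
move=> c; apply: forces_bind (IHt _ ut _ (dZ c) (iZ c) (nxx c) _ (ltyk c)) _.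
- by move=> z zt; apply: tZ; rewrite inE zt orbT.
- move=> z zt; rewrite exposed_cons eqxx (negPf nxy) andbF orbF /=.
  rewrite negb_or nxt ?inE ?zt ?orbT // andbT.
  by apply: contra yt => /eqP<-.
move=> h' [oh' sh' xt]; apply: forces_now; split=> //.
  by move=> z zh; apply: sh'; rewrite inE zh orbT.
move=> z; rewrite inE => /orP[/eqP->|/xt //].
by apply: exposed_sub sh' _; rewrite exposed_cons !eqxx.
Qed.

(** Each center in [X] is peeled off after its own star, so the next star again starts from an open
    set. *)
Lemma forces_stars (L : seq (seq V)) (X W : seq V) h :
  uniq (X ++ W) -> size L = size X ->
  (forall t, t \in L -> [/\ uniq t, size t <= k & {subset t <= W}]) ->
  open_set (X ++ W) h ->
  forces (fun h' => [/\ open_set W h', {subset h <= h'} &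
    forall t, t \in L ->
      exists2 x, x \in X & forall y, y \in t -> exposed h' x y]) h.
Proof.
elim: L X h => [|t L IHL] [|x X] h //= uXW szL Lok [dh ih].
  by apply: forces_now; do !split.
case: szL => szL; case/andP: uXW => xXW uXW.
have [ut szt tW] := Lok t (mem_head _ _).
have tXW : {subset t <= X ++ W} by move=> y /tW yW; rewrite mem_cat yW orbT.
have nx y : y \in x :: X ++ W -> ~~ exposed h x y by apply: ih; apply: mem_head.
have star := @forces_star x (X ++ W) t h uXW xXW ut tXW dh.
apply: forces_bind (star _ _ _ _) _.
- by move=> a b aZ bZ; apply: ih; rewrite inE ?aZ ?bZ orbT.
- by apply: nx; apply: mem_head.
- by move=> y /tXW yZ; apply: nx; rewrite inE yZ orbT.
- suff /eqP-> : count (exposed h x) (X ++ W) == 0 by [].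
  rewrite -leqn0 leqNgt -has_count; apply/hasPn => y yZ.
  by apply: nx; rewrite inE yZ orbT.
move=> h1 [oh1 sh1 xt]; apply: forces_bind (IHL X h1 uXW szL _ oh1) _.
  by move=> t' t'L; apply: Lok; rewrite inE t'L orbT.
move=> h2 [oh2 sh2 XL]; apply: forces_now; split=> // [z /sh1 /sh2 //|t'].
rewrite inE => /orP[/eqP->|/XL[y yX yt']].
  by exists x; rewrite ?mem_head // => y yt; apply: exposed_sub sh2 (xt y yt).
by exists y; rewrite // inE yX orbT.
Qed.

End Strategies.

(** * Rounds of the game and embedding through common neighbors *)

Section Rich.

Variables (V : eqType) (q d : nat).
Implicit Types (h : history V q) (c : 'I_q).

(* [Z] is the innermost of a decreasing chain of sets with [r] steps of color
   [c]: each small subset of a set has a common [c]-neighbor in the part of the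
   preceding set that was dropped. *)
Fixpoint rich h c (r : nat) (Z : seq V) : Prop :=
  if r is r'.+1 then
    exists Z1, [/\ {subset Z <= Z1}, rich h c r' Z1 &
      forall t, size t <= d -> {subset t <= Z} ->
      exists x, [/\ x \in Z1, x \notin Z &
                    forall y, y \in t -> color_class h c x y]]
  else True.

Lemma rich_sub h h' c r Z Z' :
  {subset h <= h'} -> {subset Z' <= Z} -> rich h c r Z -> rich h' c r Z'.
Proof.
move=> hh'; elim: r Z Z' => [|r IHr] Z Z' Z'Z //= [Z1 [ZZ1 rZ1 ext]].
exists Z1; split=> [x /Z'Z /ZZ1 //||t szt tZ'].
  exact: IHr rZ1.
have [|x [xZ1 xZ cx]] := ext t szt; first by move=> x /tZ' /Z'Z.
exists x; split=> // [|y /cx]; last exact: color_class_sub.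
by apply: contra xZ; apply: Z'Z.
Qed.

Lemma rich_embedding (T : finType) (e : rel T) h c (v0 : V) r (S : seq T) Z :
  simple_graph e -> degenerate d e -> uniq S -> rich h c (r + size S) Z ->
  exists Z' (phi : T -> V), [/\ rich h c r Z', {in S &, injective phi},
    {in S, forall x, phi x \in Z'} &
    {in S &, forall x y, e x y -> color_class h c (phi x) (phi y)}].
Proof.
move=> [e_sym e_irr] deg_e; have [n] := ubnP (size S).
elim: n S r Z => // n IHn S r Z leSn uS richZ.
have [S0|/eqP nS] := eqVneq S [::].
  by move: richZ; rewrite S0 addn0; exists Z, (fun=> v0).
have [x xS le_d] := deg_e S e uS nS e_sym (fun _ _ exy => exy).
have szS : size S = (size (rem x S)).+1.
  by rewrite size_rem // prednK //; case: (S) nS.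
(* Embed [S] without [x], keeping one step of color [c] in reserve. That step yields the image [v]
   of [x]; as [v] is in [Z1] but not in [Z'], it differs from all earlier images. *)
have [|||Z' [phi [/= [Z1 [Z'Z1 richZ1 ext]] inj_phi phiZ' hom]]] :=
    IHn (rem x S) r.+1 Z.
- by rewrite -ltnS -szS.
- exact: rem_uniq.
- by rewrite addSnnS -szS.
have [||v [vZ1 vZ' cv]] := ext (map phi [seq y <- rem x S | e x y]).
- rewrite size_map size_filter; apply: leq_trans le_d.
  exact/leq_count_subseq/rem_subseq.
- move=> w /mapP[y]; rewrite mem_filter => /andP[_ yS] ->; exact: phiZ'.
have cvphi y : y \in rem x S -> e x y -> color_class h c v (phi y).
  by move=> yS exy; apply/cv/map_f; rewrite mem_filter exy.
have SE y : y \in S -> y = x \/ y != x /\ y \in rem x S.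
  case: (eqVneq y x) => [|nyx] yS; first by left.
  by right; rewrite mem_rem_uniq // inE nyx.
exists Z1, (fun y => if y == x then v else phi y); split=> //.
- move=> y z /SE[->|[/negPf-> yS]] /SE[->|[/negPf-> zS]]; rewrite ?eqxx //.
  + by move=> vE; case/negP: vZ'; rewrite vE phiZ'.
  + by move=> vE; case/negP: vZ'; rewrite -vE phiZ'.
  + exact: inj_phi.
- by move=> y /SE[->|[/negPf-> yS]]; rewrite ?eqxx // Z'Z1 ?phiZ'.
- move=> y z /SE[->|[/negPf-> yS]] /SE[->|[/negPf-> zS]]; rewrite ?eqxx.
  + by rewrite e_irr.
  + exact: cvphi.
  + by rewrite e_sym /color_class orbC; apply: cvphi.
  + exact: hom.
Qed.

Hypothesis d_gt0 : 0 < d.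

Let k := (q * d.-1).+1.

Lemma forces_round m : exists M, forall (Z : seq V) h,
  uniq Z -> M <= size Z -> open_set k Z h ->
  forces k (fun h' => exists W c,
    [/\ uniq W, m <= size W, {subset W <= Z}, open_set k W h' &
     {subset h <= h'} /\
     forall t, size t <= d -> {subset t <= W} ->
     exists x, [/\ x \in Z, x \notin W &
                   forall y, y \in t -> color_class h' c x y]]) h.
Proof.
(* [m] is the size requested, [k] allows the case of no color to be refuted, and [d] makes room for
   padding. *)
pose m' := maxn (maxn m k) d.
have [N ramN] := ramsey (option 'I_q) V d m'.
exists (#|{: N.-tuple bool}| + N) => Z h uZ szZ oZ.
set l := #|{: N.-tuple bool}| in szZ.
pose X := take l Z; pose W := take N (drop l Z).
have szX : size X = l by rewrite size_takel // (leq_trans _ szZ) ?leq_addr.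
have szW : size W = N.
  by rewrite size_takel // size_drop leq_subRL ?(leq_trans _ szZ) ?leq_addr.
have XWZ : subseq (X ++ W) Z.
  by rewrite -[Z in subseq _ Z](cat_take_drop l) cat_subseq ?take_subseq.
have uXW := subseq_uniq XWZ uZ.
have uW : uniq W by move: uXW; rewrite cat_uniq => /and3P[].
(* Bit masks enumerate all subsets of [W]; truncation to [k] keeps every star within the degree
   bound, and all [k]-subsets still occur. *)
pose L := [seq take k (mask (tval b) W) | b : N.-tuple bool].
have subW (b : bitseq) : subseq (take k (mask b W)) W.
  exact: subseq_trans (take_subseq _ _) (mask_subseq _ _).
apply: forces_bind (@forces_stars V q k L X W h uXW _ _ _) _.
- by rewrite szX size_map -cardE.
- move=> t /mapP[b _ ->]; split; last exact: mem_subseq.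
    exact: subseq_uniq (subW _) uW.
  by rewrite size_take_min geq_minl.
- by apply: open_set_sub oZ => //; apply: mem_subseq.
move=> h' [oW hh' stars]; apply: forces_now.
pose joined t c x := all (color_class h' c x) t.
(* The color [None] of a [d]-subset means that it has no monochromatic common neighbor in [X]. *)
have [|W1 [o [W1W szW1 homo]]] :=
    ramN W (fun t => [pick c | has (joined t c) X]); first by rewrite szW.
have uW1 := subseq_uniq W1W uW.
(* [None] is impossible: a [k]-subset of [W1] has a center [x], and more than [q * d.-1] edges at
   [x] include [d] of one color. *)
case: o homo => [c|] homo; last first.
  pose t := take k W1.
  have szt : size t = k.
    by rewrite size_takel // szW1 leq_max leq_max leqnn orbT.
  have tW1 : subseq t W1 by apply: take_subseq.
  have tL : t \in L.
    have /subseqP[b szb tE] := subseq_trans tW1 W1W.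
    have szbN : size b == N by rewrite szb szW.
    apply/mapP; exists (Tuple szbN); rewrite ?mem_enum //=.
    by rewrite -tE take_oversize // szt.
  have [x xX xt] := stars t tL.
  have [||c] := @pigeonhole_count 'I_q V (fun c => color_class h' c x) d.-1 t.
  - by move=> y /xt /existsP.
  - by rewrite card_ord szt.
  rewrite prednK // => le_d.
  pose D := take d [seq y <- t | color_class h' c x y].
  have szD : size D = d by rewrite size_takel // size_filter.
  have DW1 : subseq D W1.
    apply: subseq_trans (take_subseq _ _) _.
    exact: subseq_trans (filter_subseq _ _) tW1.
  have := homo D DW1 szD; case: pickP => // /(_ c) /hasPn /(_ x xX) /allP[] y.
  by move=> /mem_take; rewrite mem_filter => /andP[].
exists W1, c; split=> //.
- by rewrite szW1 !leq_max leqnn.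
- move=> x /(mem_subseq W1W) xW; apply: (mem_subseq XWZ).
  by rewrite mem_cat xW orbT.
- by apply: open_set_sub oW => //; apply: mem_subseq.
split=> // t szt tW1.
have [|t' [t'W1 szt' tt']] := pad_subset uW1 _ szt tW1.
  by rewrite szW1 leq_max leqnn orbT.
have := homo t' t'W1 szt'; case: pickP => // c' /hasP[x xX /allP xt'] [<-].
exists x; split=> [||y /tt' /xt' //].
  by apply: (mem_subseq XWZ); rewrite mem_cat xX.
apply: contraL xX => /(mem_subseq W1W) xW; apply/negP => xX.
by move: uXW; rewrite cat_uniq => /and3P[_ /hasPn /(_ x xW) /negP].
Qed.

Hypothesis hV : infinite_type V.

Lemma uniq_seq_exists n : exists2 s : seq V, uniq s & size s = n.
Proof.
elim: n => [|n [s us <-]]; first by exists [::].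
by have [x xs] := hV s; exists (x :: s); rewrite //= xs.
Qed.

(** [r] counts the rounds by color. The size [m] varies in the induction because the earlier rounds
    must leave enough vertices for the last one. *)
Lemma forces_rich n m :
  forces k (fun h => exists Z (r : 'I_q -> nat),
    [/\ uniq Z, m <= size Z, open_set k Z h, \sum_c r c = n &
        forall c, rich h c (r c) Z]) [::].
Proof.
elim: n m => [|n IHn] m.
  have [Z uZ <-] := uniq_seq_exists m.
  apply: forces_now; exists Z, (fun=> 0); split=> //; last by rewrite big1.
  have no_edge x y : exposed ([::] : history V q) x y = false.
    by apply/existsP => -[].
  split=> [S uS /allPn[x xS xZ]|x y _ _]; last by rewrite no_edge.
  exists x; split=> //; rewrite (@eq_count _ _ pred0) ?count_pred0 //.
have [M round] := forces_round m.
apply: (forces_bind (IHn M)) => h [Z [r [uZ szZ oZ sumr richZ]]].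
apply: forces_bind (round Z h uZ szZ oZ) _.
move=> h' [W [c [uW szW WZ oW [hh' ext]]]]; apply: forces_now.
(* Color [c] gains a step from [Z] to [W]; for the other colors the chain just ends in the smaller
   set [W]. *)
exists W, (fun c' => r c' + (c' == c)); split=> //.
  rewrite big_split /= sumr (bigD1 c) //= eqxx big1 ?addn1 // => c'.
  by move/negPf->.
move=> c'; case: eqP => [->|_]; last first.
  by rewrite addn0; apply: rich_sub (richZ c').
by rewrite addn1; exists Z; split=> //; apply: rich_sub (richZ c).
Qed.

Lemma forces_mono_copy (T : finType) (e : rel T) :
  simple_graph e -> degenerate d e ->
  forces k (fun h : history V q => mono_copy e h) [::].
Proof.
move=> he deg_e; have [v0 _] := hV [::].
apply: forces_bind (forces_rich (q * #|T|).+1 0) _.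
move=> h [Z [r [_ _ _ sumr richZ]]]; apply: forces_now.
have /existsP[c ltTr] : [exists c, #|T| < r c].
  apply: contraPT sumr; rewrite negb_exists => /forallP small sumr.
  have : \sum_c r c <= \sum_(c < q) #|T|.
    by apply: leq_sum => c _; rewrite leqNgt small.
  by rewrite sumr sum_nat_const card_ord ltnn.
have szT : r c = r c - #|T| + size (enum T) by rewrite -cardE subnK // ltnW.
have [|Z' [phi [_ inj_phi _ hom]]] :=
    @rich_embedding T e h c v0 (r c - #|T|) (enum T) Z he deg_e (enum_uniq _).
  by rewrite -szT.
exists c, phi; split=> [x y|x y]; [apply: inj_phi|apply: hom];
  by rewrite mem_enum.
Qed.

End Rich.

(** * From strategy trees to Builder's functions on histories *)

Section BuilderOfStrategy.

Variables (V : choiceType) (q k : nat).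
Hypotheses (k_gt0 : 0 < k) (hV : infinite_type V).
Implicit Types h : history V q.

Definition fresh (s : seq V) : V := xchoose (hV s).

Lemma freshP s : fresh s \notin s.
Proof. exact: (xchooseP (hV s)). Qed.

Definition vertices h : seq V := [seq e.1.1 | e <- h] ++ [seq e.1.2 | e <- h].

(** The game goes on after the tree is exhausted; Builder then plays isolated edges on new
    vertices. *)
Definition fresh_edge h : V * V :=
  let x := fresh (vertices h) in (x, fresh (x :: vertices h)).

Lemma exposed_vertex h x y : exposed h x y -> x \in vertices h.
Proof.
case/existsP=> c /orP[] xyh; rewrite mem_cat; apply/orP; [left|right];
  by apply/mapP; eexists; first exact: xyh.
Qed.

Lemma fresh_edge_legal h : legal_move h (fresh_edge h).
Proof.
split=> /=.
  have := freshP (fresh (vertices h) :: vertices h).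
  by apply: contra => /eqP<-; rewrite mem_head.
by apply: contra (freshP (vertices h)); apply: exposed_vertex.
Qed.

Lemma fresh_edge_degenerate h c :
  degenerate k (exposed h) -> degenerate k (exposed ((fresh_edge h, c) :: h)).
Proof.
rewrite /fresh_edge; set x := fresh _; set y := fresh _.
move=> deg S f uS nS f_sym sf.
have nx b : exposed h x b = false.
  by apply: contraNF (freshP (vertices h)); apply: exposed_vertex.
have nxy : x == y = false.
  apply: contraNF (freshP (x :: vertices h)) => /eqP xy.
  by rewrite -/y -xy mem_head.
have [xS|xS] := boolP (x \in S).
  exists x => //; apply: leq_trans k_gt0.
  apply: leq_trans (_ : count (pred1 y) S <= 1).
    apply: sub_count => b /sf; rewrite exposed_cons nx eqxx nxy andbF !orbF.
    by [].
  by rewrite count_uniq_mem // leq_b1.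
(* [f] may contain the new edge outside [S]; restricted to [S], which misses [x], it lies in the old
   graph. *)
have [||z zS le_k] := deg S [rel a b | [&& f a b, a \in S & b \in S]] uS nS.
- by move=> a b /=; rewrite f_sym [(a \in S) && _]andbC.
- move=> a b /= /and3P[/sf]; rewrite exposed_cons => /orP[|//].
  by case/orP=> /andP[/eqP-> _]; rewrite (negPf xS).
exists z => //; apply: leq_trans le_k; rewrite -!size_filter.
apply: eq_leq; congr size; apply: eq_in_filter => b bS /=.
by rewrite zS bS !andbT.
Qed.

Definition next (s : strategy V q) (c : 'I_q) : strategy V q :=
  if s is Move _ F then F c else Stop V q.

(* Histories list the most recent move first, hence the right fold. *)
Definition current (s : strategy V q) h : strategy V q :=
  foldr (fun a s' => next s' a.2) s h.

Definition builder_of (s : strategy V q) : builder V q := fun h =>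
  if current s h is Move m _ then m else fresh_edge h.

Lemma forces_builder (Q : history V q -> Prop) :
  forces k Q [::] -> exists B : builder V q,
    (forall (P : painter V q) (n : nat),
        legal_move (play B P n) (B (play B P n)) /\
        degenerate k (exposed (play B P n))) /\
    (forall P : painter V q, exists n : nat, Q (play B P n)).
Proof.
case=> s win_s; exists (builder_of s); split=> P.
  (* The alternative [Stop] covers the moves after the win, since [Q] need not survive further
     edges. *)
  suff inv n : degenerate k (exposed (play (builder_of s) P n)) /\
      (wins k Q (current s (play (builder_of s) P n)) (play (builder_of s) P n) \/
       current s (play (builder_of s) P n) = Stop V q).
    move=> n; have [deg st] := inv n; split=> //; rewrite /builder_of.
    case: st => [|->]; last exact: fresh_edge_legal.
    by case: (current _ _) => [_|m F []] //; apply: fresh_edge_legal.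
  elim: n => [|n [deg st]] /=.
    split; last by left.
    move=> [|x S] f uS // _ _ sf; exists x; rewrite ?mem_head //.
    rewrite (@eq_count _ _ pred0) ?count_pred0 // => y.
    by apply/negP => /sf /existsP[].
  set h := play _ P n in deg st *; set c := P _ _.
  rewrite /builder_of -/(current s h); move: st.
  case: (current s h) => [_|m F [[_ dm wF]|//]] /=.
    by split; [apply: fresh_edge_degenerate|right].
  by split; [apply: dm|left; apply: wF].
(* Structural induction on the remaining tree [t] shows that [Stop] is reached. *)
suff win t n : current s (play (builder_of s) P n) = t ->
    wins k Q t (play (builder_of s) P n) ->
    exists n', Q (play (builder_of s) P n') by apply: (win s 0).
elim: t n => [|m F IH] n Es; first by move=> Qn; exists n.
case=> _ _ wF; set h := play _ _ _ in Es wF.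
have Bh : builder_of s h = m by rewrite /builder_of Es.
apply: (IH (P h m) n.+1); rewrite /= -/h Bh; last exact: wF.
by rewrite /= -/(current s h) Es.
Qed.

End BuilderOfStrategy.

Theorem theorem4p1 (q d : nat) (hq : 1 <= q) (hd : 1 <= d)
    (V : choiceType) (hV : infinite_type V)
    (T : finType) (e : rel T) (he : simple_graph e) (hdeg : degenerate d e) :
  exists B : builder V q,
    (forall (P : painter V q) (n : nat),
        legal_move (play B P n) (B (play B P n)) /\
        degenerate (q * d - (q - 1)) (exposed (play B P n))) /\
    (forall P : painter V q, exists n : nat, mono_copy e (play B P n)).
Proof.
(* With truncated subtraction this identity relies on both [q] and [d] being positive. *)
have -> : q * d - (q - 1) = (q * d.-1).+1.
  case: d q hd hq {hdeg} => [//|d'] [//|q'] _ _.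
  by rewrite mulnS subSS subn0 addSnnS addKn.
by apply: forces_builder => //; apply: forces_mono_copy.
Qed.
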